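(* Let $n\ge3$ be an integer and let $p\in\{3,5,7\}$. Then the polynomial $$h_p(\Delta_n,\leq 1)(\vec a)=\sum_{\substack{0\le v_1+\cdots+v_n\le \frac{p-1}{2}\\ v_1,\ldots,v_n\in\mathbb{Z}_{\ge0}}}\frac{a_1^{2v_1}a_2^{2v_2}\cdots a_n^{2v_n}\,a_{n+1}^{\,p-1-2\sum_{i=1}^n v_i}}{(v_1!\,v_2!\cdots v_n!)^2\,\left(p-1-2\sum_{i=1}^n v_i\right)!}\in\mathbb{F}_p[a_1,\ldots,a_{n+1}]$$ is irreducible over $\overline{\mathbb{F}}_p$, i.e. irreducible in $\overline{\mathbb{F}}_p[a_1,\ldots,a_{n+1}]$.
   Context: Here $a_1,\ldots,a_{n+1}$ are indeterminates and $\overline{\mathbb{F}}_p$ is an algebraic closure of $\mathbb{F}_p$; all factorials occurring are of integers at most $p-1$, hence invertible in $\mathbb{F}_p$. *)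

(* Defs.v *)
From HB Require Import structures.
From mathcomp Require Import all_boot all_order all_algebra.
From mathcomp Require Export mpoly.

Set Implicit Arguments.
Unset Strict Implicit.
Unset Printing Implicit Defensive.

Import GRing.Theory.
Local Open Scope ring_scope.

Definition irreducible_elt (A : idomainType) (x : A) : Prop :=
  [/\ x != 0, x \isn't a GRing.unit
    & forall y z : A, x = y * z -> y \is a GRing.unit \/ z \is a GRing.unit].

(* (K, iota) is an algebraic closure of F; that K is algebraically closed is
   part of its type. *)
Definition is_algebraic_closure (F : fieldType) (K : closedFieldType)
    (iota : {rmorphism F -> K}) : Prop :=
  forall z : K, algebraicOver iota z.

(* A multinomial v : 'X_{1..n < k.+1} is an n-tuple of naturals with
   v_1 + ... + v_n = mdeg v <= k. The indeterminates a_1, ..., a_n are the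
   'X_i with index i < n, and a_(n+1) is 'X_ord_max. *)
Definition h_simplex (p n : nat) : {mpoly 'F_p[n.+1]} :=
  \sum_(v : 'X_{1..n < (p.-1)./2.+1})
     (((\prod_(i < n) (v i)`!) ^ 2 * (p.-1 - 2 * mdeg v)`!)%N%:R : 'F_p)^-1 *:
     ((\prod_(i < n) 'X_(widen_ord (leqnSn n) i) ^+ (2 * v i)) *
      'X_ord_max ^+ (p.-1 - 2 * mdeg v)).

(* Main.v *)
Require Import Defs.
From HB Require Import structures.
From mathcomp Require Import all_boot all_order all_algebra ring.

Import GRing.Theory.
Local Open Scope ring_scope.

(** Why the polynomial is irreducible.  Suppose that a polynomial [F] of degree
    at most [d] restricts to [c s^d], [c != 0], on an affine line with
    parameter [s]; that is, the line meets the hypersurface [F = 0] in a single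
    point [P], with full multiplicity [d].  If [F = f g] with neither factor
    constant, then both [f] and [g] restrict to nonconstant divisors of
    [c s^d], so both vanish at [P], and all first derivatives of [F] vanish at
    [P].  Hence [F] is irreducible as soon as [P] is a smooth point of [F = 0].
    This is [irreducible_of_line].

    For the polynomial [h] of the theorem such a line is
    [s |-> (1, b, s, 0, ..., 0, a s)], with the last entry in the place of
    [a_(n+1)], for a suitable root [b] of [h (1, y, 0, ..., 0)].  For [p = 5]
    and [p = 7] one takes [a^2 = -2]: then all the powers of [s] strictly
    between the constant term and [s^(p-1)] drop out modulo [p].  For [p = 3]
    the form is quadratic and [a = 0] will do.  The point [s = 0] is smooth
    because [b] is a simple root.  The line needs three of the variables
    [a_1, ..., a_n], which is where [3 <= n] enters.

    It remains to evaluate [h] on vectors with at most four nonzero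
    coordinates, for every [n] ([mmap_h_simplex]); the residues of the
    coefficients modulo each of the three primes are then computed. *)

(** * A line meeting a hypersurface in one smooth point *)

Lemma horner_mmap (K : comNzRingType) N (X : 'I_N -> {poly K})
    (f : {mpoly K[N]}) (a : K) :
  (mmap polyC X f).[a] = mmap idfun (fun i => (X i).[a]) f.
Proof.
rewrite /mmap horner_sum; apply: eq_bigr => m _.
rewrite hornerM hornerC /mmap1 horner_prod; congr (_ * _).
by apply: eq_bigr => i _; rewrite horner_exp.
Qed.

Lemma size_mmap_line (K : idomainType) N (L : 'I_N -> {poly K})
    (f : {mpoly K[N]}) :
  (forall i, (size (L i) <= 2)%N) -> (size (mmap polyC L f) <= msize f)%N.
Proof.
move=> sL; rewrite /mmap; apply: (leq_trans (size_sum _ _ _)).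
apply/bigmax_leqP_seq => m mf _; rewrite mul_polyC.
apply: (leq_trans (size_scale_leq _ _)).
apply: (leq_trans _ (msize_mdeg_lt mf)).
rewrite mdegE /mmap1.
elim/big_ind2: _ => [|p1 a1 p2 a2 h1 h2|i _]; first by rewrite size_poly1.
  apply: (leq_trans (size_polyMleq _ _)).
  by rewrite -subn1 leq_subLR add1n -addSn -addnS leq_add.
apply: (leq_trans (size_poly_exp_leq _ _)); rewrite ltnS.
by rewrite -[leqRHS]mul1n leq_mul2r -subn1 leq_subLR sL orbT.
Qed.

(** [L] parametrizes the line, and [C] a curve through the point [L = 0] along
    which [F] has a nonzero derivative, which witnesses smoothness there.  The
    bound on the degree of [F] makes the degree of each factor equal to the
    degree of its restriction to the line. *)
Lemma irreducible_of_line (K : fieldType) N (F : {mpoly K[N]}) (d : nat)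
    (c : K) (L C : 'I_N -> {poly K}) :
    c != 0 -> (msize F <= d.+1)%N ->
    (forall i, (size (L i) <= 2)%N) -> mmap polyC L F = c *: 'X^d ->
    (forall i, (C i).[0] = (L i).[0]) -> (mmap polyC C F)^`().[0] != 0 ->
  irreducible_elt F.
Proof.
move=> c0 dF sL FL CL FC.
have dC0 a : (mmap polyC C a%:MP_[N])^`().[0] = 0.
  by rewrite mmapC derivC horner0.
have F0 : F != 0 by apply: contraNneq FC => ->; rewrite -mpolyC0 dC0.
split=> // [|f g FE].
  by apply: contra FC => /andP[/eqP -> _]; rewrite dC0.
(* If p does not vanish at the point, X^d divides the restriction of q, so q
   already has the full degree d and p is constant. *)
have vanish (p q : {mpoly K[N]}) : p * q = F ->
    p \is a GRing.unit \/ (mmap polyC C p).[0] = 0.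
  move=> pqF; have [p0 q0] : p != 0 /\ q != 0.
    by apply/andP; rewrite -negb_or -mulf_eq0 pqF.
  have -> : (mmap polyC C p).[0] = (mmap polyC L p).[0].
    by rewrite !horner_mmap; apply: eq_bigr => m _; congr (_ * _);
       apply: eq_bigr => i _; rewrite CL.
  have [|pP] := eqVneq (mmap polyC L p).[0] 0; [by right | left].
  have: 'X^d %| mmap polyC L p * mmap polyC L q.
    by rewrite -rmorphM /= pqF FL -mul_polyC dvdp_mull.
  rewrite Gauss_dvdpr; last first.
    by rewrite coprimep_sym coprimep_expr // coprimepX.
  move=> /dvdp_leq sq.
  have Lq0 : mmap polyC L q != 0.
    apply/eqP => Lq; have /eqP := FL.
    by rewrite -pqF rmorphM /= Lq mulr0 eq_sym scaler_eq0 (negPf c0) expf_eq0 polyX_eq0 andbF.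
  have {sq} := leq_trans (sq Lq0) (size_mmap_line _ _ _ q sL).
  rewrite size_polyXn => dq; move: dF; rewrite -pqF msizeM //.
  rewrite -subn1 leq_subLR => pq.
  have: (msize p <= 1)%N.
    by rewrite -(leq_add2r (msize q)) (leq_trans pq) // leq_add2l.
  move=> /msize1_polyC pC; rewrite pC; apply/andP; rewrite mcoeffC eqxx mulr1.
  by split=> //; rewrite unitfE -(mpolyC_eq0 N) -pC.
have [uf|uf] := vanish f g (esym FE); first by left.
have [ug|ug] := vanish g f (etrans (mulrC _ _) (esym FE)); first by right.
case/eqP: FC; rewrite FE rmorphM /= derivM hornerD !hornerM uf ug.
by rewrite mulr0 mul0r addr0.
Qed.

Lemma mmap_map_mpoly (R S : nzRingType) (T : comNzRingType) N (g : {rmorphism R -> S})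
    (f : {rmorphism S -> T}) (X : 'I_N -> T) (F : {mpoly R[N]}) :
  mmap f X (map_mpoly g F) = mmap (f \o g) X F.
Proof.
rewrite /map_mpoly [in LHS]/= {2}/mmap rmorph_sum; apply: eq_bigr => m _.
rewrite rmorphM /= mmapC; congr (_ * _).
rewrite /mmap1 rmorph_prod; apply: eq_bigr => i _.
by rewrite rmorphXn /= mmapX mmap1U.
Qed.

(** * Evaluation of h at points with four nonzero coordinates *)

Lemma msize_map_mpoly (R S : nzRingType) N (g : {rmorphism R -> S})
    (F : {mpoly R[N]}) :
  (msize (map_mpoly g F) <= msize F)%N.
Proof.
rewrite (map_mpolyE _ (leqnn (msize F))) (leq_trans (msize_sum _ _ _)) //.
apply/bigmax_leqP => m _; rewrite (leq_trans (msizeZ_le _ _)) // msizeX.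
exact: bmdeg.
Qed.

Lemma msize_h_simplex p n : (0 < p)%N -> (msize (h_simplex p n) <= p)%N.
Proof.
move=> p0; apply: (leq_trans (msize_sum _ _ _)); apply/bigmax_leqP => v _.
apply: (leq_trans (msizeZ_le _ _)).
rewrite mprodXnE mpolyXn -mpolyXD msizeX mdegD mdeg_sum !mdegMn mdeg1 mul1n.
under eq_bigr do rewrite mdegMn mdeg1 mul1n.
rewrite -big_distrr /= -mdegE subnKC ?prednK //.
by rewrite mul2n -geq_half_double -ltnS bmdeg.
Qed.

Definition mnm3 n i j k : 'X_{1..n} := [multinom nth 0%N [:: i; j; k] l | l < n].

Lemma big_ord3 (T : Type) (idx : T) (op : Monoid.law idx) n (g : nat -> T) :
    (forall l, (2 < l)%N -> g l = idx) ->
  \big[op/idx]_(l < n.+3) g l = op (op (g 0%N) (g 1%N)) (g 2%N).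
Proof.
move=> g0; rewrite !big_ord_recl big1 => [|l _]; last exact: g0.
by rewrite Monoid.mulm1 /= Monoid.mulmA.
Qed.

Lemma mdeg_mnm3 n i j k : mdeg (mnm3 n.+3 i j k) = (i + j + k)%N.
Proof.
rewrite mdegE; under eq_bigr do rewrite mnmE.
by rewrite (@big_ord3 _ _ addn _ (nth 0%N [:: i; j; k])) // => -[|[|[|[]]]].
Qed.

(** The exponents with support in the first three positions are matched with
    triples; a triple of too large a sum is sent to 0, so that it is not
    recovered from its image and is discarded by the reindexing. *)
Lemma big_bmultinom3 (S : nmodType) n d (G : 'X_{1..n.+3} -> S) :
    (forall (v : 'X_{1..n.+3}) (l : 'I_n.+3), (2 < l)%N -> v l != 0%N -> G v = 0) ->
  \sum_(v : 'X_{1..n.+3 < d.+1}) G v =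
  \sum_(i < d.+1) \sum_(j < d.+1) \sum_(k < d.+1)
    if (i + j + k <= d)%N then G (mnm3 n.+3 i j k) else 0.
Proof.
move=> G0; pose T := ('I_d.+1 * 'I_d.+1 * 'I_d.+1)%type.
pose from (u : T) : 'X_{1..n.+3 < d.+1} :=
  insubd (@bm0 n.+3 d) (mnm3 n.+3 u.1.1 u.1.2 u.2).
pose to (v : 'X_{1..n.+3 < d.+1}) : T :=
  (inord (v (inord 0)), inord (v (inord 1)), inord (v (inord 2))).
rewrite pair_big /= pair_big /= -big_mkcond /=.
rewrite (bigID (fun v => from (to v) == v)) /= [X in _ + X]big1 ?addr0; last first.
  move=> v /eqP fv; apply/eqP/negPn/negP => Gv; apply: fv.
  have vle l : (v l < d.+1)%N.
    by rewrite (leq_trans _ (bmdeg v)) // ltnS mdegE (bigD1 l) //= leq_addr.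
  have v0 (l : 'I_n.+3) : (2 < l)%N -> v l = 0%N.
    by move=> l2; apply/eqP; apply: contraTT isT => vl; case/eqP: Gv; apply: G0 vl.
  have vE : mnm3 n.+3 (v (inord 0)) (v (inord 1)) (v (inord 2)) = v :> 'X_{1..n.+3}.
    apply/mnmP => l; rewrite mnmE.
    have [l2|l2] := leqP l 2; last first.
      by rewrite (v0 l) // nth_default.
    rewrite -[in RHS](inord_val l).
    by case: (val l) l2 => [|[|[|l']]].
  by apply: val_inj; rewrite val_insubd /= !inordK // vE bmdeg.
rewrite (reindex_onto from to) /=; last by move=> v /eqP.
have fE (u : T) : bmnm (from u) =
    if (u.1.1 + u.1.2 + u.2 <= d)%N then mnm3 n.+3 u.1.1 u.1.2 u.2 else 0%MM.
  by rewrite /from val_insubd /= mdeg_mnm3 ltnS.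
apply: eq_big => [[[i j] k]|[[i j] k] /andP[_ /eqP]] /=; rewrite /to fE /=.
  case: leqP => ijk; first by rewrite !mnmE !inordK //= !inord_val !eqxx andbT.
  apply/negbTE; apply: contraTN ijk => /andP[_ /eqP].
  by rewrite !mnmE -leqNgt => -[<- <- <-]; rewrite !inordK.
case: leqP => ijk //.
by rewrite !mnmE => -[ii jj kk]; move: ijk; rewrite -ii -jj -kk !inordK.
Qed.

(** The point [(x, y, z, 0, ..., 0, t)]: [nth] supplies the zeros. *)
Definition point4 (S : nmodType) n (x y z t : S) (i : 'I_n.+1) : S :=
  if i == ord_max then t else nth 0 [:: x; y; z] i.

Lemma rmorph_Fp (S : nzRingType) p (f : {rmorphism 'F_p -> S}) (a : 'F_p) :
  f a = (a : nat)%:R.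
Proof. by rewrite -[a in LHS]natr_Zp rmorph_nat. Qed.

(** The coefficient is kept as its representative in [0, p), a closed natural
    number that can be computed for each concrete p. *)
Definition h_coef p i j k : nat :=
  (((i`! * j`! * k`!) ^ 2 * (p.-1 - 2 * (i + j + k))`!)%N%:R^-1 : 'F_p).
Arguments h_coef : simpl never.

Lemma mmap_h_simplex (S : comNzRingType) p n (f : {rmorphism 'F_p -> S})
    (x y z t : S) :
  mmap f (@point4 S n.+3 x y z t) (h_simplex p n.+3) =
  \sum_(i < (p.-1)./2.+1) \sum_(j < (p.-1)./2.+1) \sum_(k < (p.-1)./2.+1)
    if (i + j + k <= (p.-1)./2)%N then
      (h_coef p i j k)%:R *
      (x ^+ (2 * i) * y ^+ (2 * j) * z ^+ (2 * k) * t ^+ (p.-1 - 2 * (i + j + k)))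
    else 0.
Proof.
pose G (v : 'X_{1..n.+3}) : S :=
  f (((\prod_(l < n.+3) (v l)`!) ^ 2 * (p.-1 - 2 * mdeg v)`!)%N%:R^-1) *
  ((\prod_(l < n.+3) nth 0 [:: x; y; z] l ^+ (2 * v l)) *
   t ^+ (p.-1 - 2 * mdeg v)).
transitivity (\sum_(v : 'X_{1..n.+3 < (p.-1)./2.+1}) G v).
  rewrite /h_simplex rmorph_sum; apply: eq_bigr => v _.
  rewrite /= mmapZ [mmap _ _ _]rmorphM rmorph_prod rmorphXn /= mmapX mmap1U /point4 eqxx.
  congr (_ * (_ * _)); apply: eq_bigr => l _.
  rewrite rmorphXn /= mmapX mmap1U; case: eqP => // /(congr1 val) /= lE.
  by have := ltn_ord l; rewrite lE ltnn.
rewrite big_bmultinom3 => [|v l l2 vl]; last first.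
  rewrite /G [X in _ * (X * _)](bigD1 l) //= nth_default // expr0n muln_eq0 /= (negPf vl).
  by rewrite !(mul0r, mulr0).
apply: eq_bigr => i _; apply: eq_bigr => j _; apply: eq_bigr => k _.
case: ifP => // _; rewrite /G mdeg_mnm3 rmorph_Fp.
under eq_bigr do rewrite mnmE.
under [X in _ * (X * _)]eq_bigr do rewrite mnmE.
rewrite (@big_ord3 _ _ muln n (fun l => (nth 0%N [:: val i; val j; val k] l)`!));
  last by case=> [|[|[|[]]]].
rewrite (@big_ord3 _ _ *%R n
  (fun l => nth 0 [:: x; y; z] l ^+ (2 * nth 0%N [:: val i; val j; val k] l))) //.
by case=> [|[|[|[]]]].
Qed.


(** * The three primes *)

(** The line is [(1, b, s, 0, ..., 0, a s)]; smoothness at [s = 0] is tested in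
    the direction of the second coordinate. *)
Lemma irreducible_h_simplex (K : fieldType) p n (iota : {rmorphism 'F_p -> K})
    (a b c : K) (h := map_mpoly iota (h_simplex p n.+3)) :
    (0 < p)%N -> c != 0 ->
    mmap polyC (@point4 {poly K} n.+3 1 b%:P 'X (a%:P * 'X)) h = c *: 'X^(p.-1) ->
    (mmap polyC (@point4 {poly K} n.+3 1 (b%:P + 'X) 0 0) h)^`().[0] != 0 ->
  irreducible_elt h.
Proof.
move=> p0 c0 hL hC; apply: irreducible_of_line c0 _ _ hL _ hC.
- by rewrite prednK // (leq_trans (msize_map_mpoly _ _ _ _ _)) ?msize_h_simplex.
- by move=> i; rewrite /point4; case: eqP => _;
    [|case: (val i) => [|[|[|?]]] /=];
    rewrite ?nth_nil ?size_poly0 ?size_poly1 ?size_polyX ?(leq_trans (size_polyC_leq1 _)) //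
    ?mul_polyC ?(leq_trans (size_scale_leq _ _)) ?size_polyX.
move=> i; rewrite /point4; case: eqP => _; first by rewrite !hornerE.
by case: (val i) => [|[|[|?]]] /=; rewrite ?nth_nil !hornerE.
Qed.

Ltac expand_h := rewrite mmap_h_simplex /= !big_ord_recr !big_ord0 /=;
  repeat match goal with
  | |- context [h_coef ?p ?i ?j ?k] =>
      let v := eval vm_compute in (h_coef p i j k) in change (h_coef p i j k) with v
  end.

Lemma mmap_h_simplex3 (S : comNzRingType) n (f : {rmorphism 'F_3 -> S})
    (x y z t : S) :
  mmap f (@point4 S n.+3 x y z t) (h_simplex 3 n.+3) =
  x ^+ 2 + y ^+ 2 + z ^+ 2 + 2 * t ^+ 2.
Proof. expand_h; ring. Qed.

(** Powers of [t] are written through [t ^+ 2], which is [- 2 * z ^+ 2] on the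
    line used for 5 and 7. *)
Lemma mmap_h_simplex5 (S : comNzRingType) n (f : {rmorphism 'F_5 -> S})
    (x y z t : S) :
  mmap f (@point4 S n.+3 x y z t) (h_simplex 5 n.+3) =
  4 * (x ^+ 4 + y ^+ 4 + z ^+ 4)
  + (x ^+ 2 * y ^+ 2 + x ^+ 2 * z ^+ 2 + y ^+ 2 * z ^+ 2)
  + 3 * (x ^+ 2 + y ^+ 2 + z ^+ 2) * t ^+ 2 + 4 * (t ^+ 2) ^+ 2.
Proof. expand_h; ring. Qed.

Lemma mmap_h_simplex7 (S : comNzRingType) n (f : {rmorphism 'F_7 -> S})
    (x y z t : S) :
  mmap f (@point4 S n.+3 x y z t) (h_simplex 7 n.+3) =
  x ^+ 6 + y ^+ 6 + z ^+ 6
  + 2 * (x ^+ 4 * (y ^+ 2 + z ^+ 2) + y ^+ 4 * (x ^+ 2 + z ^+ 2)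
         + z ^+ 4 * (x ^+ 2 + y ^+ 2))
  + x ^+ 2 * y ^+ 2 * z ^+ 2
  + (x ^+ 4 + y ^+ 4 + z ^+ 4
     + 4 * (x ^+ 2 * y ^+ 2 + x ^+ 2 * z ^+ 2 + y ^+ 2 * z ^+ 2)) * t ^+ 2
  + 5 * (x ^+ 2 + y ^+ 2 + z ^+ 2) * (t ^+ 2) ^+ 2 + 6 * (t ^+ 2) ^+ 3.
Proof. expand_h; ring. Qed.

Lemma natr_char (S : nzRingType) p (f : {rmorphism 'F_p -> S}) :
  prime p -> p%:R = 0 :> S.
Proof. by move=> pP; rewrite -(rmorph_nat f) pchar_Fp_0 // rmorph0. Qed.

Lemma irreducible_h_simplex3 (K : closedFieldType) n (iota : {rmorphism 'F_3 -> K}) :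
  irreducible_elt (map_mpoly iota (h_simplex 3 n.+3)).
Proof.
have K3 : 3 = 0 :> K by apply: natr_char iota _.
have [b bE] : exists b : K, b ^+ 2 + 1 = 0.
  have [b bE] := solve_monicpoly (fun i => nth 0 [:: -1; 0] i : K) (isT : (0 < 2)%N).
  by exists b; rewrite bE !big_ord_recr big_ord0 /=; ring.
apply: (irreducible_h_simplex _ _ _ _ 0 b 1) => //; first exact: oner_neq0.
  rewrite mmap_map_mpoly (mmap_h_simplex3 _ _ (polyC \o iota)) /=.
  rewrite polyC0 mul0r.
  transitivity ((b ^+ 2 + 1)%:P + 'X ^+ 2); first by rewrite polyCD polyC_exp; ring.
  by rewrite bE add0r scale1r.
rewrite mmap_map_mpoly (mmap_h_simplex3 _ _ (polyC \o iota)) /=.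
rewrite [X in X != 0](_ : _ = 2 * b); last by rewrite !derivE !hornerE /=; ring.
apply/eqP => d; case/eqP: (oner_neq0 K).
(* An expression of 1 in the ideal generated by 3, b^2 + 1 and 2 b. *)
transitivity (3 - 2 * (b ^+ 2 + 1) + b * (2 * b) : K); first by ring.
by rewrite K3 bE d; ring.
Qed.

Lemma sqrt_minus2 (K : closedFieldType) : exists a : K, a ^+ 2 = - 2.
Proof.
have [a aE] := solve_monicpoly (fun i => nth 0 [:: -2; 0] i : K) (isT : (0 < 2)%N).
by exists a; rewrite aE !big_ord_recr big_ord0 /=; ring.
Qed.

(** With [z = t = 0], [h (1, y, 0, ..., 0)] is [4 (y^4 - y^2 + 1)] modulo 5. *)
Lemma irreducible_h_simplex5 (K : closedFieldType) n (iota : {rmorphism 'F_5 -> K}) :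
  irreducible_elt (map_mpoly iota (h_simplex 5 n.+3)).
Proof.
have K5 : 5 = 0 :> K by apply: natr_char iota _.
have [a aE] := sqrt_minus2 K.
have [b bE] : exists b : K, b ^+ 4 - b ^+ 2 + 1 = 0.
  have [b bE] := solve_monicpoly (fun i => nth 0 [:: -1; 0; 1; 0] i : K) (isT : (0 < 4)%N).
  by exists b; rewrite bE !big_ord_recr big_ord0 /=; ring.
apply: (irreducible_h_simplex _ _ _ _ a b (-1)) => //.
- by rewrite oppr_eq0 oner_neq0.
- rewrite mmap_map_mpoly (mmap_h_simplex5 _ _ (polyC \o iota)) /=.
  have -> : (a%:P * 'X) ^+ 2 = - 2 * 'X ^+ 2 :> {poly K}.
    by rewrite exprMn -polyC_exp aE polyCN polyC_natr.
  transitivity (- 'X ^+ 4 + 4 * (b ^+ 4 - b ^+ 2 + 1)%:P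
    + 5%:P * (b%:P ^+ 2 - (1 + b%:P ^+ 2) * 'X ^+ 2 + 3 * 'X ^+ 4)).
    by rewrite polyC_natr !polyCD polyCN !polyC_exp; ring.
  by rewrite bE K5 scaleN1r; ring.
rewrite mmap_map_mpoly (mmap_h_simplex5 _ _ (polyC \o iota)) /=.
set Y : {poly K} := b%:P + 'X.
rewrite [X in X^`()](_ : _ = Y ^+ 4 *+ 4 + Y ^+ 2 + 4%:P);
  last by rewrite polyC_natr; ring.
rewrite [X in X != 0](_ : _ = 16 * b ^+ 3 + 2 * b);
  last by rewrite !derivE !hornerE /=; ring.
apply/eqP => d; case/eqP: (oner_neq0 K).
(* An expression of 1 in the ideal generated by 5, b^4 - b^2 + 1 and the
   derivative: modulo 5, the resultant of b^4 - b^2 + 1 and b^3 + 2 b is a unit.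
   Reducing the former by the latter leaves 3 b^2 - 1, and
   9 (b^4 - b^2 + 1) = (3 b^2 - 1) (3 b^2 - 2) + 7. *)
transitivity (3 * (9 * (b ^+ 4 - b ^+ 2 + 1) - (b * (16 * b ^+ 3 + 2 * b)
   - 5 * (3 * b ^+ 4) - (b ^+ 4 - b ^+ 2 + 1)) * (3 * b ^+ 2 - 2)) - 4 * 5 : K).
  by ring.
by rewrite K5 bE d; ring.
Qed.

(** Here [b] can be taken in the prime field: 3 is a simple root of
    [h (1, y, 0, ..., 0) = 1 + y^6 + 2 (y^4 + y^2)], whose derivative at 3 is
    1686 = 7 * 241 - 1. *)
Lemma irreducible_h_simplex7 (K : closedFieldType) n (iota : {rmorphism 'F_7 -> K}) :
  irreducible_elt (map_mpoly iota (h_simplex 7 n.+3)).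
Proof.
have K7 : 7 = 0 :> K by apply: natr_char iota _.
have [a aE] := sqrt_minus2 K.
apply: (irreducible_h_simplex _ _ _ _ a 3 (-1)) => //.
- by rewrite oppr_eq0 oner_neq0.
- rewrite mmap_map_mpoly (mmap_h_simplex7 _ _ (polyC \o iota)) /=.
  have -> : (a%:P * 'X) ^+ 2 = - 2 * 'X ^+ 2 :> {poly K}.
    by rewrite exprMn -polyC_exp aE polyCN polyC_natr.
  transitivity (- 'X ^+ 6
    + 7%:P * (130 - 9 * 'X ^+ 2 + 20 * 'X ^+ 4 - 4 * 'X ^+ 6) : {poly K}).
    by rewrite !polyC_natr; ring.
  by rewrite K7 scaleN1r; ring.
rewrite mmap_map_mpoly (mmap_h_simplex7 _ _ (polyC \o iota)) /=.
set Y : {poly K} := 3%:P + 'X.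
rewrite [X in X^`()](_ : _ = Y ^+ 6 + (Y ^+ 4 + Y ^+ 2) *+ 2 + 1%:P);
  last by ring.
rewrite [X in X != 0](_ : _ = 7 * 241 - 1);
  last by rewrite !derivE !hornerE /=; ring.
by rewrite K7 mul0r sub0r oppr_eq0 oner_neq0.
Qed.

Theorem mainTheorem3 (n p : nat) (hn : (3 <= n)%N) (hp : p \in [:: 3; 5; 7]%N)
    (K : closedFieldType) (iota : {rmorphism 'F_p -> K})
    (hK : is_algebraic_closure iota) :
  irreducible_elt (map_mpoly iota (h_simplex p n)).
Proof.
case: n hn => [|[|[|n]]] // _ {hK}; rewrite !inE in hp.
case/or3P: hp iota => /eqP -> iota.
- exact: irreducible_h_simplex3.
- exact: irreducible_h_simplex5.
- exact: irreducible_h_simplex7.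
Qed.
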